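(* Let $A=K[x,y]/(x^a,y^b)$, where $a,b\ge 2$ are integers and $K$ is a field of characteristic $p>2$. Write $a$ and $b$ in base $p$, that is, $a=a_kp^k+\dots+a_1p+a_0$ and $b=b_\ell p^\ell+\dots+b_1p+b_0$, where $0\le a_i,b_i<p$ and $a_k,b_\ell\neq 0$. Assume (as one may, after possibly exchanging the roles of $a$ and $b$) that $\ell\ge k$. Then: 1. When $a,b<p$, $A$ has the strong Lefschetz property (SLP) if and only if $a+b\le p+1$. 2. When $a<p$ and $b\ge p$, $A$ has the SLP if and only if $a\le \min(b_0,p-b_0)+1$. 3. When $a,b\ge p$, $A$ has the SLP if and only if the following three conditions are all satisfied: (a) $a_0\in\{\frac{p-1}{2},\frac{p+1}{2}\}$ and $b_0\in\{\frac{p-1}{2},\frac{p+1}{2}\}$ (independently of each other); (b) $a_i=b_i=\frac{p-1}{2}$ for $i=1,2,\dots,k-1$; (c) $a_k+b_k\le p-1$, and moreover $b_k\ge a_k$ when $\ell>k$.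
   Context: Polynomial rings carry the standard grading, and quotients by homogeneous ideals the induced grading $A=\bigoplus_{i\ge 0}A_i$. A linear map is said to have maximal rank if it is injective or surjective. A graded algebra $A$ has the strong Lefschetz property (SLP) if there exists $\ell\in A_1$ such that the multiplication maps $\cdot\ell^m:A_i\to A_{i+m}$ have maximal rank for all $i\ge 0$ and all $m\ge 1$. *)

(* Defs.v *)
From HB Require Import structures.
From mathcomp Require Import all_boot all_order all_algebra.
From mathcomp Require Import generic_quotient ring_quotient.
From mathcomp Require Import boolp classical_sets functions.
From mathcomp Require Import mpoly.

Set Implicit Arguments.
Unset Strict Implicit.
Unset Printing Implicit Defensive.

Import GRing.Theory.

Local Open Scope ring_scope.
Local Open Scope quotient_scope.
Local Open Scope classical_set_scope.

(* The linear structure plays no role in injectivity or surjectivity, so a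
   grading is given here just by its family of homogeneous components; a linear
   map between subspaces D and E is a function f mapping D into E. *)
Definition max_rank (U V : Type) (D : set U) (E : set V) (f : U -> V) : Prop :=
  set_inj D f \/ set_surj D E f.

Definition strong_Lefschetz (A : comNzRingType) (A_ : nat -> set A) : Prop :=
  exists2 l : A, A_ 1%N l &
    forall i m : nat, (0 < m)%N ->
      max_rank (A_ i) (A_ (i + m)%N) (fun u : A => l ^+ m * u).

Section MonomialCompleteIntersection.
Variables (K : fieldType) (a b : nat).

Definition xvar : {mpoly K[2]} := 'X_ord0.
Definition yvar : {mpoly K[2]} := 'X_ord_max.

(* The library's {ideal_quot _} only accepts proper ideals, hence the positivity
   arguments; they are needed for properness but do not affect membership. *)
Definition mci_ideal (a_gt0 : (0 < a)%N) (b_gt0 : (0 < b)%N) :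
    {mpoly K[2]} -> bool :=
  fun f => `[< exists u v : {mpoly K[2]}, f = u * xvar ^+ a + v * yvar ^+ b >].

Variables (a_gt0 : (0 < a)%N) (b_gt0 : (0 < b)%N).

Lemma mci_ideal_closed : idealr_closed (mci_ideal a_gt0 b_gt0).
Proof.
split.
- by apply/asboolP; exists 0, 0; rewrite !mul0r addr0.
- apply/negP => /asboolP [u [v /(congr1 (fun f => f.@[fun=> 0]))]].
  rewrite mevalD !mevalM !rmorphXn /= !mevalXU !expr0n.
  by rewrite (gtn_eqF a_gt0) (gtn_eqF b_gt0) !mulr0 addr0 meval1 => /eqP; rewrite oner_eq0.
- move=> c f g /asboolP [u [v ->]] /asboolP [u' [v' ->]].
  apply/asboolP; exists (c * u + u'), (c * v + v').
  by rewrite mulrDr !mulrDl !mulrA addrACA.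
Qed.

HB.instance Definition _ :=
  isIdealr.Build {mpoly K[2]} (mci_ideal a_gt0 b_gt0) mci_ideal_closed.

Definition mci_idealr : idealr {mpoly K[2]} := mci_ideal a_gt0 b_gt0.

Definition mci := {ideal_quot mci_idealr}.

Definition mci_gr (i : nat) : set mci :=
  [set \pi_mci f | f in [set f : {mpoly K[2]} | f \is i.-homog]].

End MonomialCompleteIntersection.

Definition mci_SLP (K : fieldType) (a b : nat)
    (a_gt0 : (0 < a)%N) (b_gt0 : (0 < b)%N) : Prop :=
  strong_Lefschetz (@mci_gr K a b a_gt0 b_gt0).

(* Main.v *)
Require Import Defs.
From mathcomp Require Import all_boot all_order all_algebra.
From mathcomp Require Import generic_quotient ring_quotient mpoly.
From mathcomp Require Import boolp classical_sets functions zify ring.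

(** With A = a - n and B = b - n, multiplication by (x + y)^(A + B) from degree
    n - 1 to the complementary degree is the n x n Toeplitz matrix with entries
    C(A + B, A + t - s), and the SLP holds iff all of these, for 0 < n < min(a, b),
    are invertible; the other symmetric pairs of degrees give unitriangular
    matrices, and any linear form with nonzero coefficients gives the same matrices
    up to diagonal factors. Row operations of Pascal type give
    det * prod_(r < n) (A+r)! (B+r)! = prod_(r < n) (A+B+r)! r!,
    and Legendre's formula expresses the p-adic valuation of det as a sum over
    q = p^e of nonnegative terms. The term at q only depends on A, B, n modulo q,
    and it vanishes iff one of the residues is 0 or their sum is at most q or at
    least 2q. Letting n vary, this becomes for q <= a, b that a %% q and b %% q are
    (q-1)/2 or (q+1)/2, for a < q <= b that a - 1 <= b %% q <= q + 1 - a, and for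
    q > a, b that a + b <= q + 1; these conditions are then read off the digits. *)

Set Implicit Arguments.
Unset Strict Implicit.
Unset Printing Implicit Defensive.

Import GRing.Theory.
Local Open Scope quotient_scope.

(** * Binomial Toeplitz determinants *)

Local Open Scope ring_scope.

(** Terms with s > r vanish, so any longer range still gives Vandermonde's convolution. *)
Lemma Vandermonde_le r m k M : (r < M)%N ->
  (\sum_(s < M) 'C(r, s) * (if s <= k then 'C(m, k - s) else 0))%N = 'C(r + m, k).
Proof.
move=> lt_rM; pose F s := ('C(r, s) * (if s <= k then 'C(m, k - s) else 0))%N.
transitivity (\sum_(s < M + k.+1) F s)%N.
  rewrite big_split_ord /= [X in (_ + X)%N]big1 ?addn0 // => s _.
  by rewrite /F bin_small //; lia.
rewrite addnC big_split_ord /= [X in (_ + X)%N]big1 ?addn0 => [|s _].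
  rewrite -binomial.Vandermonde; apply: eq_bigr => s _.
  by rewrite /F -ltnS ltn_ord.
by rewrite /F ifN ?muln0 //; lia.
Qed.

(** The guard encodes C(m, j) = 0 for negative j. On row vectors this is multiplication by (1 + X)^m
    between runs of N consecutive coefficients, the target run starting A places later. *)
Definition binmx (R : pzRingType) (N A m : nat) : 'M[R]_N :=
  \matrix_(s, t) (if (s <= A + t)%N then 'C(m, A + t - s) else 0%N)%:R.

Definition pascal_mx (R : pzRingType) (N : nat) : 'M[R]_N := \matrix_(r, s) 'C(r, s)%:R.

Section BinMx.
Variables (R : comNzRingType) (N : nat).

Lemma det_pascal_mx : \det (pascal_mx R N) = 1.
Proof.
rewrite det_trig; first by apply: big1 => i _; rewrite mxE binn.
by apply/is_trig_mxP => i j lt_ij; rewrite mxE bin_small.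
Qed.

Lemma pascal_mx_mul_binmx A m :
  pascal_mx R N *m binmx R N A m = \matrix_(r, t) 'C(m + r, A + t)%:R.
Proof.
apply/matrixP => r t; rewrite !mxE addnC -(@Vandermonde_le _ _ _ N) // natr_sum.
by apply: eq_bigr => s _; rewrite !mxE natrM.
Qed.

Lemma det_binmx0 m : \det (binmx R N 0 m) = 1.
Proof.
rewrite -det_tr det_trig.
  by apply: big1 => i _; rewrite !mxE add0n leqnn subnn bin0.
by apply/is_trig_mxP => i j lt_ij; rewrite !mxE add0n leqNgt lt_ij.
Qed.

Lemma det_binmx_diag A : \det (binmx R N A A) = 1.
Proof.
rewrite det_trig.
  by apply: big1 => i _; rewrite !mxE leq_addl addnK binn.
apply/is_trig_mxP => i j lt_ij; rewrite !mxE ifT ?bin_small //; lia.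
Qed.

(* Row [r] of the product with the Pascal matrix is [(A+B+r)! / (A+t)! (B+r)!]
   times the falling factorial [(B+r)^_t], and these falling factorials are again
   a Pascal matrix times a matrix of the same family, with [A = 0]. *)
Lemma det_binmx A B :
  \det (binmx R N A (A + B)) * (\prod_(r < N) ((A + r)`! * (B + r)`!))%N%:R =
  (\prod_(r < N) ((A + B + r)`! * r`!))%N%:R.
Proof.
pose d (f : nat -> nat) : 'M[R]_N := diag_mx (\row_r (f r)%:R).
have det_d f : \det (d f) = (\prod_(r < N) f r)%N%:R.
  by rewrite det_diag natr_prod; apply: eq_bigr => r _; rewrite mxE.
have eq_mx :
  d (fun r => (B + r)`!) *m (pascal_mx R N *m binmx R N A (A + B)) *m
    d (fun t => (A + t)`!) =
  d (fun r => (A + B + r)`!) *m (pascal_mx R N *m binmx R N 0 B) *m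
    d (fun t => t`!).
  rewrite !pascal_mx_mul_binmx /d !mul_diag_mx !mul_mx_diag.
  apply/matrixP => r t; rewrite !mxE -!natrM; congr (_%:R).
  rewrite add0n -!mulnA (bin_ffact (B + r)).
  have [le_t|lt_t] := leqP t (B + r); last first.
    by rewrite bin_small ?ffact_small ?muln0 //; lia.
  have le_At : (A + t <= A + B + r)%N by lia.
  have := bin_fact le_At; rewrite -addnA subnDl => <-.
  rewrite -(ffact_fact le_t).
  ring.
have /(congr1 determinant) := eq_mx.
rewrite !det_mulmx !det_d !det_pascal_mx det_binmx0 !mul1r mulr1 !big_split /=.
by rewrite !natrM => <-; rewrite mulrC -mulrA [RHS]mulrC mulrC !mulrA.
Qed.
End BinMx.

Local Close Scope ring_scope.

(** * Valuations *)

(** By Legendre's formula, this is the contribution of q = p^e to the valuation of prod_(r < n) (x +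
    r)!. *)
Definition floor_sum q x n := \sum_(r < n) (x + r) %/ q.

Lemma floor_sumS q x n : floor_sum q x n.+1 = floor_sum q x n + (x + n) %/ q.
Proof. by rewrite /floor_sum big_ord_recr. Qed.

(** Hermite's identity; the step in x evaluates a sum of q + 1 consecutive terms in two ways. *)
Lemma floor_sum_period q x : 0 < q -> floor_sum q x q = x.
Proof.
move=> q_gt0; elim: x => [|x IH].
  rewrite /floor_sum big1 // => r _; rewrite add0n divn_small //.
have: floor_sum q x q.+1 = x %/ q + floor_sum q x.+1 q.
  rewrite /floor_sum big_ord_recl addn0; congr (_ + _).
  by apply: eq_bigr => r _; rewrite /bump /= addSnnS.
rewrite floor_sumS IH divnDr // divnn q_gt0 => eq_sums; lia.
Qed.

Lemma floor_sumDq q x n : 0 < q -> floor_sum q (x + q) n = floor_sum q x n + n.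
Proof.
move=> q_gt0; elim: n => [|n IH]; first by rewrite /floor_sum !big_ord0.
rewrite [in LHS]floor_sumS IH (addnAC x) divnDr ?dvdnn // divnn q_gt0 floor_sumS; lia.
Qed.

Lemma floor_sum_nDq q x n : 0 < q ->
  floor_sum q x (n + q) = floor_sum q x n + (x + n).
Proof.
move=> q_gt0; rewrite {1}/floor_sum big_split_ord /=; congr (_ + _).
rewrite -[RHS](@floor_sum_period q) //.
by apply: eq_bigr => r _; rewrite addnA.
Qed.

(** The equality case of [floor_sum_leqif], where q contributes nothing to the valuation of the
    determinant of size C. *)
Definition residue_cond q A B C :=
  [|| q %| A, q %| B, q %| C, A %% q + B %% q + C %% q <= q |
      q.*2 <= A %% q + B %% q + C %% q].

(** Each floor is [q <= x + r] + [2q <= x + r]; the truncated differences count the r < n satisfying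
    each inequality. *)
Lemma floor_sum_small q x n : x < q.*2 -> n <= q ->
  floor_sum q x n = (x + n - q) - (x - q) + (x + n - q.*2).
Proof.
move=> x_lt; elim: n => [|n IH] n_le.
  rewrite /floor_sum big_ord0; lia.
rewrite floor_sumS IH; last by lia.
have -> : (x + n) %/ q = (q <= x + n) + (q.*2 <= x + n).
  have [lt1|ge1] := ltnP (x + n) q; first by rewrite divn_small //; lia.
  have [lt2|ge2] := ltnP (x + n) q.*2.
    rewrite -(subnK ge1) divnDr // divnn divn_small; lia.
  rewrite -(subnK ge2) divnDr -?muln2 ?dvdn_mulr // mulKn ?divn_small; lia.
lia.
Qed.

Lemma leqif_eqD c m n m' n' b : m' = m + c -> n' = n + c ->
  (m' <= n' ?= iff b) <-> (m <= n ?= iff b).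
Proof. by move=> -> ->; rewrite /leqif leq_add2r eqn_add2r. Qed.

(** Adding q to A, B or C changes both sides equally, so residues suffice. For these the claim is (A
    + B - q) + (A + C - q) + (B + C - q) <= (A + B + C - q) + (A + B + C - 2q) in truncated
    subtraction, which is checked by cases. *)
Lemma floor_sum_leqif q A B C : 0 < q ->
  floor_sum q A C + floor_sum q B C <=
    floor_sum q (A + B) C + floor_sum q 0 C ?= iff residue_cond q A B C.
Proof.
move=> q_gt0.
have step_n A' B' C' i cond :
  floor_sum q A' (C' + i * q) + floor_sum q B' (C' + i * q) <=
    floor_sum q (A' + B') (C' + i * q) + floor_sum q 0 (C' + i * q)
    ?= iff cond <->
  floor_sum q A' C' + floor_sum q B' C' <=
    floor_sum q (A' + B') C' + floor_sum q 0 C' ?= iff cond.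
  elim: i => [|i IH]; first by rewrite mul0n addn0.
  rewrite -IH mulSn [q + _]addnC addnA !floor_sum_nDq //.
  set C'' := C' + _; apply: (@leqif_eqD (A' + B' + C'' + C'')); lia.
have step_x A' B' C' i j cond :
  floor_sum q (A' + i * q) C' + floor_sum q (B' + j * q) C' <=
    floor_sum q (A' + i * q + (B' + j * q)) C' + floor_sum q 0 C'
    ?= iff cond <->
  floor_sum q A' C' + floor_sum q B' C' <=
    floor_sum q (A' + B') C' + floor_sum q 0 C' ?= iff cond.
  have shift x k : floor_sum q (x + k * q) C' = floor_sum q x C' + k * C'.
    elim: k => [|k IH]; first by rewrite !mul0n !addn0.
    rewrite mulSn [q + _]addnC addnA floor_sumDq // IH; lia.
  rewrite addnACA -mulnDl !shift mulnDl.
  apply: (@leqif_eqD (i * C' + j * C')); lia.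
have -> : residue_cond q A B C = residue_cond q (A %% q) (B %% q) (C %% q).
  by rewrite /residue_cond !modn_mod /dvdn !modn_mod.
rewrite {1 2}(divn_eq A q) {1 2}(divn_eq B q) {1 2 3 4}(divn_eq C q).
rewrite ![_ * q + _]addnC; apply/step_n/step_x.
have := (ltn_pmod A q_gt0, ltn_pmod B q_gt0, ltn_pmod C q_gt0).
move: (A %% q) (B %% q) (C %% q) => {}A {}B {}C [[A_lt B_lt] C_lt].
have -> : residue_cond q A B C =
    [|| A == 0, B == 0, C == 0, A + B + C <= q | q.*2 <= A + B + C].
  by rewrite /residue_cond /dvdn !modn_small.
rewrite !floor_sum_small; try lia.
clear -A_lt B_lt C_lt.
have -> : A - q = 0 by lia.
have -> : B - q = 0 by lia.
have -> : 0 + C - q - (0 - q) + (0 + C - q.*2) = 0 by lia.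
have -> : A + C - q.*2 = 0 by lia.
have -> : B + C - q.*2 = 0 by lia.
rewrite !subn0 !addn0.
have [hAB|hAB] := leqP (A + B) q; have [hC|hC] := leqP (A + B + C) q;
have [hAC|hAC] := leqP (A + C) q; have [hBC|hBC] := leqP (B + C) q;
have [h2|h2] := leqP q.*2 (A + B + C); try (exfalso; lia); (split; [lia|]).
all: by apply/eqP/idP => [?|/or4P[/eqP?|/eqP?|/eqP?|?]]; lia.
Qed.

(** * Residue conditions according to the position of q relative to a and b *)

Definition residue_conds q a b := forall n, 0 < n -> n < minn a b ->
  residue_cond q (a - n) (b - n) n.

Lemma residue_conds_ge q a b : odd q -> 1 < q -> q <= a -> q <= b ->
  residue_conds q a b <-> [/\ q.-1 <= (a %% q).*2, (a %% q).*2 <= q.+1,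
                         q.-1 <= (b %% q).*2 & (b %% q).*2 <= q.+1].
Proof.
move=> odd_q q_gt1 le_qa le_qb.
have q_gt0 : 0 < q by lia.
have [lt_a lt_b] := (ltn_pmod a q_gt0, ltn_pmod b q_gt0).
split=> [cond|[lo_a hi_a lo_b hi_b] n n_gt0]; last first.
  rewrite leq_min => /andP[lt_na lt_nb].
  have lt_n := ltn_pmod n q_gt0.
  rewrite /residue_cond /dvdn (modnB q_gt0 (ltnW lt_na)) (modnB q_gt0 (ltnW lt_nb)).
  move: (a %% q) (b %% q) (n %% q) lt_a lt_b lt_n lo_a hi_a lo_b hi_b.
  clear -q_gt0 => x y z lt_x lt_y lt_z lo_x hi_x lo_y hi_y.
  (* If z exceeds both x and y, the residues sum to x + y + 2q - z >= 2q; if it exceeds neither and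
     z > 0, to x + y - z <= q. If it exceeds just one, it equals the other, since x and y differ by
     at most 1. *)
  case: (ltnP x z) => le_xz; case: (ltnP y z) => le_yz; rewrite ?mul1n ?mul0n.
  - apply/orP; right; apply/orP; right; apply/orP; right; apply/orP; right; lia.
  - apply/orP; right; apply/orP; left; lia.
  - apply/orP; left; lia.
  have [->|z_neq0] := eqVneq z 0; first by rewrite !orbT.
  apply/orP; right; apply/orP; right; apply/orP; right; apply/orP; left; lia.
have {}cond g : 0 < g -> g < q ->
    let A := (a %% q < g) * q + a %% q - g in
    let B := (b %% q < g) * q + b %% q - g in
    [|| A == 0, B == 0, A + B + g <= q | q.*2 <= A + B + g].
  move=> g_gt0 lt_gq /=.
  have le_ga : g <= a by apply: leq_trans (ltnW lt_gq) le_qa.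
  have le_gb : g <= b by apply: leq_trans (ltnW lt_gq) le_qb.
  have: g < minn a b by rewrite leq_min !(leq_trans lt_gq).
  move/(cond g g_gt0); rewrite /residue_cond /dvdn.
  rewrite (modnB q_gt0 le_ga) (modnB q_gt0 le_gb) (modn_small lt_gq).
  by rewrite [g == 0]gtn_eqF // orFb.
have [h q_eq] : exists h, q = h.*2.+1.
  by exists q./2; rewrite -[LHS]odd_double_half odd_q.
move: (a %% q) (b %% q) lt_a lt_b cond => x y lt_x lt_y cond.
clear -q_gt1 q_eq lt_x lt_y cond.
(* The values n = y - 1, x - 1, 1 and q - 1, available because q <= a and q <= b, give in turn y <=
   x + 1, x <= y + 1, x + y <= q + 1 and q - 1 <= x + y. As q is odd, this confines each of x and y
   to (q - 1)/2 and (q + 1)/2. *)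
have le_yx : y <= x.+1.
  rewrite leqNgt; apply/negP => lt_xy.
  have y1_gt0 : 0 < y.-1 by lia.
  have y1_lt : y.-1 < q by lia.
  have := cond y.-1 y1_gt0 y1_lt => /=.
  have -> : x < y.-1 by lia.
  have -> : y < y.-1 = false by lia.
  by rewrite mul1n mul0n => /or4P[/eqP?|/eqP?|?|?]; lia.
have le_xy : x <= y.+1.
  rewrite leqNgt; apply/negP => lt_yx.
  have x1_gt0 : 0 < x.-1 by lia.
  have x1_lt : x.-1 < q by lia.
  have := cond x.-1 x1_gt0 x1_lt => /=.
  have -> : y < x.-1 by lia.
  have -> : x < x.-1 = false by lia.
  by rewrite mul1n mul0n => /or4P[/eqP?|/eqP?|?|?]; lia.
have hi : x + y <= q.+1.
  rewrite leqNgt; apply/negP => lt_q.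
  have := cond 1 isT q_gt1 => /=.
  have -> : x < 1 = false by lia.
  have -> : y < 1 = false by lia.
  by rewrite !mul0n => /or4P[/eqP?|/eqP?|?|?]; lia.
have lo : q.-1 <= x + y.
  rewrite leqNgt; apply/negP => lt_q.
  have q1_gt0 : 0 < q.-1 by lia.
  have q1_lt : q.-1 < q by lia.
  have := cond q.-1 q1_gt0 q1_lt => /=.
  have -> : x < q.-1 by lia.
  have -> : y < q.-1 by lia.
  by rewrite !mul1n => /or4P[/eqP?|/eqP?|?|?]; lia.
split; lia.
Qed.

(** Since n < a < q, the residues of a - n and n add up to a. Then n = a - 1 gives the lower bound
    on b mod q, and n = 1 the upper one. *)
Lemma residue_conds_between q a b : 1 < a -> a < q -> q <= b ->
  residue_conds q a b <-> a <= (b %% q).+1 /\ a + b %% q <= q.+1.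
Proof.
move=> a_gt1 lt_aq le_qb.
have q_gt0 : 0 < q by lia.
have min_ab : minn a b = a by lia.
rewrite /residue_conds min_ab.
have res n : 0 < n -> n < a ->
    residue_cond q (a - n) (b - n) n =
    let B := (b %% q < n) * q + b %% q - n in
    [|| B == 0, a + B <= q | q.*2 <= a + B].
  move=> n_gt0 lt_na /=.
  have le_nb : n <= b by lia.
  have lt_anq : a - n < q by lia.
  have lt_nq : n < q by lia.
  rewrite /residue_cond /dvdn (modnB q_gt0 le_nb).
  rewrite (modn_small lt_anq) (modn_small lt_nq).
  rewrite [a - n == 0]gtn_eqF ?subn_gt0 // [n == 0]gtn_eqF //=.
  by rewrite addnAC subnK // ltnW.
have lt_b := ltn_pmod b q_gt0.
split=> [cond|[lo hi] n n_gt0 lt_na]; last first.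
  rewrite res //=; case: ltnP => lt_n; rewrite ?mul1n ?mul0n.
    by apply/orP; right; apply/orP; right; lia.
  by apply/orP; right; apply/orP; left; lia.
have {}cond n : 0 < n -> n < a ->
    let B := (b %% q < n) * q + b %% q - n in
    [|| B == 0, a + B <= q | q.*2 <= a + B].
  by move=> n_gt0 lt_na; rewrite -res //; apply: cond.
move: (b %% q) lt_b cond => y lt_y cond.
clear -a_gt1 lt_aq lt_y cond.
have lo : a <= y.+1.
  rewrite leqNgt; apply/negP => lt_ya.
  have a1_gt0 : 0 < a.-1 by lia.
  have a1_lt : a.-1 < a by lia.
  have := cond a.-1 a1_gt0 a1_lt => /=.
  have -> : y < a.-1 by lia.
  by rewrite mul1n => /or3P[/eqP?|?|?]; lia.
split=> //; have := cond 1 isT a_gt1 => /=.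
case: (posnP y) => [->|y_gt0]; first by rewrite mul1n addn0 => _; lia.
have -> : y < 1 = false by lia.
by rewrite mul0n => /or3P[/eqP?|?|?]; lia.
Qed.

(** All three numbers are their own residues, with sum a + b - n < 2q, and n = 1 is the strictest
    case. *)
Lemma residue_conds_lt q a b : 1 < a -> 1 < b -> a < q -> b < q ->
  residue_conds q a b <-> a + b <= q.+1.
Proof.
move=> a_gt1 b_gt1 lt_aq lt_bq.
have res n : 0 < n -> n < minn a b ->
    residue_cond q (a - n) (b - n) n = (a + b - n <= q).
  rewrite leq_min => n_gt0 /andP[lt_na lt_nb].
  have lt_anq : a - n < q by lia.
  have lt_bnq : b - n < q by lia.
  have lt_nq : n < q by lia.
  rewrite /residue_cond /dvdn (modn_small lt_anq) (modn_small lt_bnq).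
  rewrite (modn_small lt_nq) !gtn_eqF ?subn_gt0 //=.
  apply/orP/idP => [[]|]; lia.
split=> [cond|le_ab n n_gt0 lt_n]; last by rewrite res //; lia.
have lt_1 : 1 < minn a b by rewrite leq_min a_gt1.
have := cond 1 isT lt_1; rewrite res //; lia.
Qed.

(** Legendre's formula with a common number M of terms, so that sums for several factorials can be
    combined termwise. *)
Lemma logn_fact_lt p n M : prime p -> n <= M ->
  logn p n`! = \sum_(k < M) n %/ p ^ k.+1.
Proof.
move=> p_pr le_nM; rewrite logn_fact // big_add1 big_mkord.
rewrite (big_ord_widen_cond M xpredT (fun k => n %/ p ^ k.+1)) //.
rewrite [RHS](bigID (fun k : 'I_M => k < n)) /=.
rewrite [X in _ = _ + X]big1 ?addn0 // => k; rewrite -leqNgt => le_nk.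
by rewrite divn_small // (leq_trans (ltn_expl n (prime_gt1 p_pr))) // leq_exp2l ?prime_gt1 // ltnW.
Qed.

Lemma det_binmx_neq0 (K : fieldType) p n A B : p \in [pchar K]%R ->
  (\det (binmx K n A (A + B)) != 0)%R <->
  forall e, 0 < e -> residue_cond (p ^ e) A B n.
Proof.
move=> pK; have p_pr := pcharf_prime pK; have p_gt1 := prime_gt1 p_pr.
pose D := (\det (binmx int n A (A + B)))%R.
have -> : (\det (binmx K n A (A + B)) = D%:~R)%R.
  rewrite -det_map_mx; congr (\det _)%R; apply/matrixP => s t.
  by rewrite !mxE rmorph_nat.
have -> : (D%:~R == 0 :> K)%R = (p %| `|D|).
  rewrite (dvdn_pcharf pK) [in LHS](intEsign D) rmorphM rmorph_sign /=.
  by rewrite mulf_eq0 signr_eq0.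
have := congr1 absz (det_binmx int n A B); rewrite abszM !natz !absz_nat -/D.
set X := \prod_(r < n) _; set Y := \prod_(r < n) _ => eqXY.
have logn_prod F : (forall i : 'I_n, 0 < F i) ->
    logn p (\prod_i F i) = \sum_i logn p (F i).
  (* The relation also carries positivity, which additivity of [logn] requires. *)
  move=> F_gt0; pose Q x y := (0 < x) && (logn p x == y).
  suff /andP[_ /eqP//] : Q (\prod_i F i) (\sum_i logn p (F i)).
  apply: (big_ind2 Q) => [|x1 y1 x2 y2|i _]; rewrite /Q ?F_gt0 ?logn1 ?eqxx //.
  case/andP=> x1_gt0 /eqP<- /andP[x2_gt0 /eqP<-].
  by rewrite muln_gt0 x1_gt0 x2_gt0 lognM ?eqxx.
have X_gt0 : 0 < X by apply: prodn_gt0 => r; rewrite muln_gt0 !fact_gt0.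
have Y_gt0 : 0 < Y by apply: prodn_gt0 => r; rewrite muln_gt0 !fact_gt0.
have D_gt0 : 0 < `|D| by move: Y_gt0; rewrite -eqXY muln_gt0 => /andP[].
pose M := A + B + n.
have lognX : logn p X =
    \sum_(k < M) (floor_sum (p ^ k.+1) A n + floor_sum (p ^ k.+1) B n).
  rewrite logn_prod => [|r]; last by rewrite muln_gt0 !fact_gt0.
  rewrite /floor_sum; under [RHS]eq_bigr do rewrite -big_split.
  rewrite exchange_big; apply: eq_bigr => r _; have lt_rn := ltn_ord r.
  by rewrite lognM ?fact_gt0 // !(@logn_fact_lt _ _ M) -?big_split // /M; lia.
have lognY : logn p Y =
    \sum_(k < M) (floor_sum (p ^ k.+1) (A + B) n + floor_sum (p ^ k.+1) 0 n).
  rewrite logn_prod => [|r]; last by rewrite muln_gt0 !fact_gt0.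
  rewrite /floor_sum; under [RHS]eq_bigr do rewrite -big_split.
  rewrite exchange_big; apply: eq_bigr => r _; have lt_rn := ltn_ord r.
  by rewrite lognM ?fact_gt0 // !(@logn_fact_lt _ _ M) -?big_split // /M; lia.
have leXY : logn p X <= logn p Y
    ?= iff [forall k : 'I_M, residue_cond (p ^ k.+1) A B n].
  rewrite lognX lognY; apply: leqif_sum => k _.
  by apply: floor_sum_leqif; rewrite expn_gt0 ltnW.
have -> : (~~ (p %| `|D|)) = [forall k : 'I_M, residue_cond (p ^ k.+1) A B n].
  rewrite -(geq_leqif leXY) -eqXY lognM // -[X in _ <= X]add0n leq_add2r.
  by rewrite leqNgt -(pfactor_dvdn 1 p_pr D_gt0).
split=> [/forallP res [//|e] _|res]; last by apply/forallP => k; apply: res.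
have [lt_eM|le_Me] := ltnP e M; first exact: (res (Ordinal lt_eM)).
(* Such a power exceeds A + B + n, so the residues are the numbers themselves and their sum is at
   most q. *)
have lt_M : M < p ^ e.+1.
  by rewrite (leq_trans (ltn_expl M p_gt1)) // leq_exp2l // ltnW.
rewrite /residue_cond !(modn_small (leq_ltn_trans _ lt_M)) /M; try lia.
Qed.

(** * Multiplication matrices of the algebra *)

Local Open Scope ring_scope.

Section Quot.
Variables (K : fieldType) (a b : nat) (a_gt0 : (0 < a)%N) (b_gt0 : (0 < b)%N).
Local Notation Q := (mci K a_gt0 b_gt0).
Local Notation pi := (\pi_Q).

Lemma pi_eq (f g : {mpoly K[2]}) :
  pi f = pi g <-> exists u v, f - g = u * xvar K ^+ a + v * yvar K ^+ b.
Proof.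
split=> [/eqP|H].
  by rewrite -Quotient.idealrBE => /asboolP.
by apply/eqP; rewrite -Quotient.idealrBE; apply/asboolP.
Qed.

Lemma piM f g : pi (f * g) = pi f * pi g.
Proof. exact: rmorphM. Qed.
Lemma piX f n : pi (f ^+ n) = pi f ^+ n.
Proof. exact: rmorphXn. Qed.
Lemma pi0 : pi 0 = 0.
Proof. exact: rmorph0. Qed.
End Quot.

(** * Binary forms, dehomogenization and membership in the ideal *)

Definition bimon (s t : nat) : 'X_{1..2} := [multinom if i == ord0 then s else t | i < 2].

Lemma bimon0 s t : bimon s t ord0 = s.
Proof. by rewrite mnmE. Qed.

Lemma bimon1 s t : bimon s t ord_max = t.
Proof. by rewrite mnmE. Qed.

Lemma mdeg2E (m : 'X_{1..2}) : mdeg m = (m ord0 + m ord_max)%N.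
Proof. by rewrite mdegE big_ord_recl big_ord1; congr (_ + m _)%N; apply: val_inj. Qed.

Lemma bimon_eta (m : 'X_{1..2}) : bimon (m ord0) (m ord_max) = m.
Proof.
apply/mnmP => i; rewrite mnmE; case: ifP => [/eqP->//|].
by case: i => [[|[|]]] // lt _; congr (m _); apply: val_inj.
Qed.

Section Dehomogenization.
Variable K : fieldType.
Implicit Types f g : {mpoly K[2]}.

(** Setting y = 1 loses nothing in a fixed degree and turns products of forms into products of
    univariate polynomials. *)
Definition dehom f : {poly K} :=
  mmap (@polyC K) (fun i : 'I_2 => if i == ord0 then 'X else 1) f.

Lemma dehomM f g : dehom (f * g) = dehom f * dehom g.
Proof. exact: rmorphM. Qed.

Lemma dehomXn f n : dehom (f ^+ n) = dehom f ^+ n.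
Proof. exact: rmorphXn. Qed.

Lemma dehom_mon c (m : 'X_{1..2}) : dehom (c *: 'X_[m]) = c *: 'X^(m ord0).
Proof.
rewrite /dehom mmapZ mmapX /mmap1 big_ord_recl big_ord1 /= expr1n mulr1.
by rewrite mul_polyC.
Qed.

Lemma dehom_sum (I : Type) (r : seq I) (F : I -> {mpoly K[2]}) :
  dehom (\sum_(i <- r) F i) = \sum_(i <- r) dehom (F i).
Proof. exact: raddf_sum. Qed.

Lemma dhomog2E d f : f \is d.-homog ->
  f = \sum_(s < d.+1) f@_(bimon s (d - s)) *: 'X_[bimon s (d - s)].
Proof.
move=> f_hom; apply/mpolyP => m; rewrite raddf_sum /=.
under eq_bigr do rewrite mcoeffZ mcoeffX.
have [m_d|m_nd] := eqVneq (mdeg m) d; last first.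
  rewrite (dhomog_nemf_coeff f_hom m_nd) big1 // => s _.
  case: eqP => [m_eq|]; last by rewrite mulr0.
  by case/eqP: m_nd; rewrite -m_eq mdeg2E bimon0 bimon1 subnKC // -ltnS.
have lt_m : (m ord0 < d.+1)%N by rewrite ltnS -m_d mdeg2E leq_addr.
have m_eq : bimon (m ord0) (d - m ord0) = m.
  by rewrite -m_d mdeg2E addKn bimon_eta.
rewrite (bigD1 (Ordinal lt_m)) //= m_eq eqxx mulr1 big1 ?addr0 // => s.
apply: contraNeq; case: (bimon _ _ =P m) => [s_eq _|]; last by rewrite mulr0 eqxx.
by apply/eqP/val_inj => /=; rewrite -s_eq bimon0.
Qed.

Lemma dehom_homog d f : f \is d.-homog ->
  dehom f = \poly_(s < d.+1) f@_(bimon s (d - s)).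
Proof.
move=> f_hom; rewrite {1}(dhomog2E f_hom) dehom_sum poly_def.
by apply: eq_bigr => s _; rewrite dehom_mon bimon0.
Qed.

Lemma coef_dehom d f s : f \is d.-homog -> (s <= d)%N ->
  (dehom f)`_s = f@_(bimon s (d - s)).
Proof. by move=> f_hom le_sd; rewrite (dehom_homog f_hom) coef_poly ltnS le_sd. Qed.

Lemma mulXn_coef0 (u : {mpoly K[2]}) (i : 'I_2) n (m : 'X_{1..2}) : (m i < n)%N ->
  (u * 'X_i ^+ n)@_m = 0.
Proof.
move=> lt_mn; rewrite mpolyXn; apply/eqP; rewrite mcoeff_eq0.
rewrite (perm_mem (msuppMX u _)); apply/mapP => -[m' _ m_eq].
by move: lt_mn; rewrite m_eq mnmDE mulmnE mnm1E eqxx mul1n; lia.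
Qed.

Lemma mci_memP a b f :
  (exists u v, f = u * xvar K ^+ a + v * yvar K ^+ b) <->
  forall m : 'X_{1..2}, (m ord0 < a)%N -> (m ord_max < b)%N -> f@_m = 0.
Proof.
split=> [[u [v ->]] m lt_ma lt_mb|f0].
  by rewrite mcoeffD !mulXn_coef0 ?addr0.
have divX (i : 'I_2) n (m : 'X_{1..2}) : (n <= m i)%N ->
    'X_[m] = 'X_[K, m - U_(i) *+ n] * 'X_i ^+ n :> {mpoly K[2]}.
  move=> le_nm; rewrite mpolyXn -mpolyXD submK //.
  apply/mnm_lepP => j; rewrite mulmnE mnm1E.
  by case: eqP => [<-|_]; rewrite ?mul1n ?mul0n.
(* Monomials divisible by x^a go to the first cofactor; by the assumption on f, every other monomial
   of its support is divisible by y^b. *)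
exists (\sum_(m <- msupp f | (a <= (m : 'X_{1..2}) ord0)%N)
  f@_m *: 'X_[m - U_(ord0) *+ a]).
exists (\sum_(m <- msupp f | ~~ (a <= (m : 'X_{1..2}) ord0)%N)
  f@_m *: 'X_[m - U_(ord_max) *+ b]).
rewrite {1}[f]mpolyE (bigID (fun m : 'X_{1..2} => a <= m ord0)%N) /=.
rewrite !mulr_suml; congr (_ + _); apply: eq_bigr => m le_m.
  by rewrite -scalerAl -divX.
have [le_bm|lt_mb] := leqP b (m ord_max); first by rewrite -scalerAl -divX.
by rewrite f0 ?scale0r ?mul0r // ltnNge.
Qed.

End Dehomogenization.

(** * Monomial bases of the graded pieces and matrices of multiplication maps *)

Section Window.
Variables (K : fieldType) (a b : nat) (a_gt0 : (0 < a)%N) (b_gt0 : (0 < b)%N).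
Local Notation Q := (mci K a_gt0 b_gt0).
Local Notation pi := (\pi_Q).
Local Notation gr := (@mci_gr K a b a_gt0 b_gt0).

(** The x-exponents of the degree d monomials that survive in the quotient form an interval. The
    conjunct s <= d guards the truncated d - s. *)
Definition is_window d s0 N :=
  forall s, [&& s <= d, s < a & d - s < b]%N = (s0 <= s < s0 + N)%N.

Definition hom_window d s0 N (v : 'rV[K]_N) : {mpoly K[2]} :=
  \sum_(s < N) v 0 s *: 'X_[bimon (s0 + s) (d - (s0 + s))].

Lemma dehom_hom_window d s0 N (v : 'rV[K]_N) :
  dehom (hom_window d s0 v) = \sum_(s < N) v 0 s *: 'X^(s0 + s).
Proof. by rewrite dehom_sum; apply: eq_bigr => s _; rewrite dehom_mon bimon0. Qed.

Lemma coef_dehom_hom_window d s0 N (v : 'rV[K]_N) (j : 'I_N) :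
  (dehom (hom_window d s0 v))`_(s0 + j) = v 0 j.
Proof.
rewrite dehom_hom_window coef_sum (bigD1 j) //= coefZ coefXn eqxx mulr1.
rewrite big1 ?addr0 // => s /negPf ne_sj.
by rewrite coefZ coefXn eqn_add2l eq_sym val_eqE ne_sj mulr0.
Qed.

Section FixWindow.
Variables (d s0 N : nat) (win : is_window d s0 N).

Lemma window_bounds (j : 'I_N) : [/\ s0 + j <= d, s0 + j < a & d - (s0 + j) < b]%N.
Proof. by apply/and3P; rewrite win leq_addr ltn_add2l ltn_ord. Qed.

Lemma hom_window_homog (v : 'rV[K]_N) : hom_window d s0 v \is d.-homog.
Proof.
apply: rpred_sum => s _; apply: rpredZ; rewrite dhomogX /= mdeg2E bimon0 bimon1.
by have [le_d _ _] := window_bounds s; rewrite subnKC.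
Qed.

Lemma gr_hom_window (v : 'rV[K]_N) : gr d (pi (hom_window d s0 v)).
Proof. by exists (hom_window d s0 v) => //; apply: hom_window_homog. Qed.

(** Monomials outside the window lie in the ideal. *)
Lemma pi_hom_window f : f \is d.-homog ->
  pi f = pi (hom_window d s0 (\row_(j < N) (dehom f)`_(s0 + j))).
Proof.
move=> f_hom; set v := \row__ _; apply/pi_eq/mci_memP => m lt_ma lt_mb.
have [m_d|m_nd] := eqVneq (mdeg m) d; last first.
  by apply: dhomog_nemf_coeff m_nd; rewrite rpredB ?hom_window_homog.
have m1_eq : m ord_max = (d - m ord0)%N by rewrite -m_d mdeg2E addKn.
have m_win : (s0 <= m ord0 < s0 + N)%N.
  by rewrite -win lt_ma -m1_eq lt_mb -m_d mdeg2E leq_addr.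
have le_md : (m ord0 <= d)%N by rewrite -m_d mdeg2E leq_addr.
have lt_j : (m ord0 - s0 < N)%N by lia.
have m0_eq : m ord0 = (s0 + Ordinal lt_j)%N by rewrite /= subnKC; case/andP: m_win.
rewrite -(bimon_eta m) m1_eq mcoeffB -!coef_dehom ?hom_window_homog //.
by rewrite m0_eq coef_dehom_hom_window mxE subrr.
Qed.

Lemma pi_hom_window_inj (v w : 'rV[K]_N) :
  pi (hom_window d s0 v) = pi (hom_window d s0 w) -> v = w.
Proof.
move/pi_eq/mci_memP => mem0; apply/rowP => j.
have [le_d lt_a lt_b] := window_bounds j.
have := mem0 (bimon (s0 + j) (d - (s0 + j))); rewrite bimon0 bimon1 => /(_ lt_a lt_b).
rewrite mcoeffB -!coef_dehom ?hom_window_homog // !coef_dehom_hom_window.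
exact: subr0_eq.
Qed.
End FixWindow.

(** The matrix, acting on row vectors, of multiplication by a form with dehomogenization P, in the
    monomial bases of windows starting at s0 and t0. *)
Definition toeplitz_mx (P : {poly K}) s0 t0 N : 'M[K]_N :=
  \matrix_(s, t) (if (s0 + s <= t0 + t)%N then P`_(t0 + t - (s0 + s)) else 0).

Lemma pi_mul_hom_window i m s0 t0 N (f : {mpoly K[2]}) (v : 'rV[K]_N) :
    is_window i s0 N -> is_window (i + m) t0 N -> f \is 1.-homog ->
  pi f ^+ m * pi (hom_window i s0 v) =
  pi (hom_window (i + m) t0 (v *m toeplitz_mx (dehom f ^+ m) s0 t0 N)).
Proof.
move=> win_i win_im f_hom; rewrite -piX -piM.
have g_hom : f ^+ m * hom_window i s0 v \is (i + m).-homog.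
  rewrite addnC; apply: dhomogM (hom_window_homog win_i v).
  by have := dhomogMn m f_hom; rewrite mul1n.
rewrite (pi_hom_window win_im g_hom); congr (pi (hom_window _ _ _)).
apply/rowP => t; rewrite !mxE dehomM dehomXn dehom_hom_window mulr_sumr coef_sum.
apply: eq_bigr => s _; rewrite mxE -scalerAr coefZ coefMXn.
by case: ltnP.
Qed.

Section MaxRank.
Variables (i m s0 t0 N : nat) (f : {mpoly K[2]}).
Hypotheses (win_i : is_window i s0 N) (win_im : is_window (i + m) t0 N).
Hypothesis f_hom : f \is 1.-homog.
Let T := toeplitz_mx (dehom f ^+ m) s0 t0 N.
Let mul (u : Q) : Q := pi f ^+ m * u.

Lemma toeplitz_bij : \det T != 0 ->
  set_inj (gr i) mul /\ set_surj (gr i) (gr (i + m)) mul.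
Proof.
move=> detT; have T_unit : T \in unitmx by rewrite unitmxE unitfE.
split=> [u1 u2 /set_mem[f1 f1_hom <-] /set_mem[f2 f2_hom <-]|w [g g_hom <-]].
  rewrite (pi_hom_window win_i f1_hom) (pi_hom_window win_i f2_hom) /mul.
  rewrite !(pi_mul_hom_window _ win_i win_im f_hom).
  by move/(pi_hom_window_inj win_im)/(can_inj (mulmxK T_unit)) => ->.
rewrite (pi_hom_window win_im g_hom); set w0 := \row__ _.
exists (pi (hom_window i s0 (w0 *m invmx T))); first exact: gr_hom_window.
by rewrite /mul (pi_mul_hom_window _ win_i win_im f_hom) mulmxKV.
Qed.

(** Both windows have length N, so T is square: injectivity excludes a left kernel, and surjectivity
    yields a left inverse made of preimages of the unit rows. *)
Lemma max_rank_toeplitz : max_rank (gr i) (gr (i + m)) mul -> \det T != 0.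
Proof.
case=> [inj|surj].
  apply/negP => /det0P[v v_neq0 vT0]; case/eqP: v_neq0.
  apply: (pi_hom_window_inj win_i); apply: inj; try exact/mem_set/gr_hom_window.
  by rewrite /mul !(pi_mul_hom_window _ win_i win_im f_hom) vT0 mul0mx.
have lift (w : 'rV[K]_N) : exists v, v *m T = w.
  have [_ [g g_hom <-]] := surj _ (gr_hom_window win_im w).
  rewrite (pi_hom_window win_i g_hom) /mul (pi_mul_hom_window _ win_i win_im f_hom).
  by move/(pi_hom_window_inj win_im); eexists; eassumption.
have [V VT1] : exists V, V *m T = 1%:M.
  exists (\matrix_j projT1 (cid (lift (row j 1%:M)))).
  by apply/row_matrixP => j; rewrite row_mul rowK; case: cid.
by rewrite -unitfE -unitmxE; case/mulmx1_unit: VT1.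
Qed.
End MaxRank.
End Window.

(** * The strong Lefschetz property in terms of determinants *)

Section LefschetzDet.
Variables (K : fieldType) (a b : nat) (a_gt0 : (0 < a)%N) (b_gt0 : (0 < b)%N).
Local Notation Q := (mci K a_gt0 b_gt0).
Local Notation pi := (\pi_Q).
Local Notation gr := (@mci_gr K a b a_gt0 b_gt0).

Lemma gr_mul_expr (f : {mpoly K[2]}) d k (u : Q) :
  f \is 1.-homog -> gr d u -> gr (d + k) (pi f ^+ k * u).
Proof.
move=> f_hom [g g_hom <-]; exists (f ^+ k * g); last by rewrite piM piX.
by have := dhomogMn k f_hom; rewrite mul1n addnC => fk_hom; apply: dhomogM.
Qed.

Lemma coef_linear_expr (x y : K) m u :
  ((x *: 'X + y%:P) ^+ m)`_u = x ^+ u * y ^+ (m - u) *+ 'C(m, u).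
Proof.
rewrite addrC exprDn coef_sum.
under eq_bigr => k _.
  rewrite coefMn exprZn -polyC_exp mul_polyC coefZ coefZ coefXn mulrCA.
  over.
have [lt_um|lt_mu] := ltnP u m.+1.
  rewrite (bigD1 (Ordinal lt_um)) //= eqxx mulr1 mulrC big1 ?addr0 // => k.
  by rewrite -val_eqE eq_sym /= => /negPf ->; rewrite !mulr0 mul0rn.
rewrite bin_small // mulr0n big1 // => k _.
by rewrite gtn_eqF ?mulr0 ?mul0rn // (leq_trans (ltn_ord k)).
Qed.

Lemma toeplitz_binmx m s0 A N :
  toeplitz_mx ((1 *: 'X + 1%:P) ^+ m) s0 (s0 + A) N = binmx K N A m.
Proof.
apply/matrixP => s t; rewrite !mxE coef_linear_expr !expr1n mulr1.
by rewrite -addnA leq_add2l subnDl; case: ifP.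
Qed.

Lemma det_toeplitz_linear (x y : K) A B N : x != 0 -> y != 0 ->
  \det (toeplitz_mx ((x *: 'X + y%:P) ^+ (A + B)) 0 A N) != 0 ->
  \det (binmx K N A (A + B)) != 0.
Proof.
move=> x_neq0 y_neq0.
(* With u = A + t - s, the factor x^u y^(A + B - u) splits into a part in s and a part in t; [N] is
   added to the exponents of y to keep them natural. *)
pose D1 := diag_mx (\row_(s < N) (x ^+ s * y ^+ (N - s))).
pose D2 := diag_mx (\row_(t < N) (x ^+ (A + t) * y ^+ (B + N - t))).
have eqT : D1 *m toeplitz_mx ((x *: 'X + y%:P) ^+ (A + B)) 0 A N =
           binmx K N A (A + B) *m D2.
  rewrite mul_diag_mx mul_mx_diag; apply/matrixP => s t; rewrite !mxE !add0n.
  case: ifP => le_s; last by rewrite mulr0 mul0r.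
  have [le_t|lt_t] := leqP (A + t - s) (A + B); last first.
    by rewrite coef_linear_expr bin_small // mulr0n mulr0 mul0r.
  rewrite coef_linear_expr -[in LHS]mulr_natl mulrCA; congr (_ * _).
  have lt_sN := ltn_ord s; have lt_tN := ltn_ord t.
  rewrite mulrACA -!exprD; congr (_ ^+ _ * _ ^+ _); lia.
have := congr1 determinant eqT; rewrite !det_mulmx => det_eq detT.
apply: contraTneq (detT) => det0; rewrite det0 mul0r in det_eq.
move/eqP: det_eq; rewrite mulf_eq0 (negPf detT) orbF det_diag.
move/prodf_eq0 => [s _]; rewrite mxE mulf_eq0 !expf_eq0 (negPf x_neq0).
by rewrite (negPf y_neq0) !andbF.
Qed.

Lemma linear_homog_dehom (f : {mpoly K[2]}) : f \is 1.-homog ->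
  exists x y, dehom f = x *: 'X + y%:P.
Proof.
move=> f_hom; rewrite (dehom_homog f_hom) poly_def !big_ord_recl big_ord0 /=.
by rewrite addr0 expr0 addrC alg_polyC; eexists; eexists.
Qed.

Lemma window_low i : (i < a)%N -> (i < b)%N -> is_window a b i 0 i.+1.
Proof.
move=> lt_ia lt_ib s; rewrite add0n ltnS leq0n.
by apply/and3P/idP => [[]|le_si] //; split; lia.
Qed.

(** The degree is a + b - 2 - i, complementary to i, written as i + A + B for n = i + 1. *)
Lemma window_low_dual i : (i < a)%N -> (i < b)%N ->
  is_window a b (i + (a - i.+1 + (b - i.+1))) (a - i.+1) i.+1.
Proof.
by move=> lt_ia lt_ib s; apply/and3P/andP => [[]|[]] *; split; lia.
Qed.

(** Maps between complementary degrees suffice: any other multiplication map is the first factor of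
    an injective one, the last factor of a surjective one, or has target 0. *)
Lemma SLP_det : (1 < a)%N -> (1 < b)%N ->
  mci_SLP K a_gt0 b_gt0 <->
  forall n, (0 < n)%N -> (n < minn a b)%N ->
    \det (binmx K n (a - n) (a - n + (b - n))) != 0.
Proof.
move=> a_gt1 b_gt1; split=> [[_ [f f_hom <-] slp]|dets].
  have [x [y f_eq]] := linear_homog_dehom f_hom.
  have detT i : (i.+1 < a)%N -> (i.+1 < b)%N ->
      \det (toeplitz_mx (dehom f ^+ (a - i.+1 + (b - i.+1))) 0 (a - i.+1) i.+1) != 0.
    move=> lt_ia lt_ib; apply: (@max_rank_toeplitz _ _ _ a_gt0 b_gt0) (f_hom) _.
    - by apply: window_low; lia.
    - by apply: window_low_dual; lia.
    by apply: slp; lia.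
  (* For i = 0 the only entry is C(a + b - 2, a - 1) x^(a - 1) y^(b - 1), with both exponents
     positive. *)
  have [x_neq0 y_neq0] : x != 0 /\ y != 0.
    have := detT 0 a_gt1 b_gt1; rewrite f_eq det_mx11 mxE coef_linear_expr.
    rewrite -mulr_natl !mulf_eq0 !negb_or => /and3P[_].
    rewrite !expf_eq0 !negb_and => /orP[|]; last first.
      by move=> x_neq0 /orP[|]; last by []; lia.
    by lia.
  case=> // i _; rewrite leq_min => /andP[lt_ia lt_ib].
  by apply: det_toeplitz_linear x_neq0 y_neq0 _; rewrite -f_eq; apply: detT.
pose f : {mpoly K[2]} := xvar K + yvar K.
have f_hom : f \is 1.-homog by rewrite rpredD ?dhomogX /= ?mdeg1.
have f_eq : dehom f = 1 *: 'X + 1%:P.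
  rewrite /dehom rmorphD /= !mmapX !mmap1U /= scale1r.
  by congr (_ + _).
pose c := (a + b - 2)%N.
(* For i >= a the offset of the windows is 0, and for i >= b it equals the exponent c - 2i; both
   give unitriangular matrices. One of the two also happens when i + 1 = min(a, b). The remaining i
   are covered by [dets]. *)
have bij i : (i.*2 <= c)%N ->
    set_inj (gr i) (fun u : Q => pi f ^+ (c - i.*2) * u) /\
    set_surj (gr i) (gr (c - i)) (fun u : Q => pi f ^+ (c - i.*2) * u).
  move=> le_ic.
  have -> : (c - i = i + (c - i.*2))%N by lia.
  have [lt_ia|le_ai] := ltnP i a; last first.
    apply: (@toeplitz_bij _ _ _ a_gt0 b_gt0 _ _ 0 0 a) f_hom _.
    - by move=> s; apply/and3P/andP => [[]|[]] *; split; lia.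
    - by move=> s; apply/and3P/andP => [[]|[]] *; split; lia.
    by rewrite f_eq (toeplitz_binmx _ 0 0) det_binmx0 oner_eq0.
  have [lt_ib|le_bi] := ltnP i b; last first.
    apply: (@toeplitz_bij _ _ _ a_gt0 b_gt0 _ _ (i.+1 - b) (a - i.+1) b) f_hom _.
    - by move=> s; apply/and3P/andP => [[]|[]] *; split; lia.
    - by move=> s; apply/and3P/andP => [[]|[]] *; split; lia.
    have -> : (a - i.+1 = i.+1 - b + (c - i.*2))%N by lia.
    by rewrite f_eq toeplitz_binmx det_binmx_diag oner_eq0.
  have -> : (c - i.*2 = a - i.+1 + (b - i.+1))%N by lia.
  apply: (@toeplitz_bij _ _ _ a_gt0 b_gt0 _ _ 0 (a - i.+1) i.+1) f_hom _.
  - exact: window_low.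
  - exact: window_low_dual.
  rewrite f_eq (toeplitz_binmx _ 0 (a - i.+1)).
  have [lt_i|le_i] := ltnP i.+1 (minn a b); first exact: dets.
  have [i_eq|i_eq] : (a = i.+1 \/ b = i.+1)%N by lia.
    by rewrite i_eq subnn det_binmx0 oner_eq0.
  have -> : (b - i.+1 = 0)%N by lia.
  by rewrite addn0 det_binmx_diag oner_eq0.
exists (pi f) => [|i m m_gt0]; first by exists f.
(* Here i + m <= c - i, so the m-th power is a factor of the injective power c - 2i. *)
have [le_imc|lt_cim] := leqP (i.*2 + m) c.
  left; have [|inj _] := bij i; first by lia.
  move=> u1 u2 gr_u1 gr_u2 eq_u; apply: inj => //.
  by rewrite (_ : c - i.*2 = (c - i.*2 - m) + m)%N ?exprD -?mulrA ?eq_u //; lia.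
(* Degrees above c are 0; otherwise the bijection from degree c - (i + m) onto degree i + m passes
   through degree i. *)
right=> w gr_w; have [le_imc|lt_cim2] := leqP (i + m) c; last first.
  have win0 : is_window a b (i + m) 0 0.
    by move=> s; rewrite addn0 ltn0 andbF; apply/and3P => -[]; lia.
  case: gr_w => g g_hom <-; exists 0; first by exists 0; [apply: rpred0 | apply: pi0].
  by rewrite mulr0 (pi_hom_window _ _ win0 g_hom) /hom_window big_ord0 pi0.
have [|_ surj] := bij (c - (i + m))%N; first by lia.
have [|u gr_u <-] := surj w; first by rewrite subKn.
exists (pi f ^+ (i - (c - (i + m))) * u).
  have := gr_mul_expr (i - (c - (i + m))) f_hom gr_u.
  by rewrite subnKC //; lia.
by rewrite mulrA -exprD; congr (_ ^+ _ * _); lia.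
Qed.
End LefschetzDet.

Local Close Scope ring_scope.

(** * Digits *)

Section Digits.
Variables (p : nat) (c : nat -> nat) (k : nat).
Hypothesis c_lt : forall i, i <= k -> c i < p.
Local Notation S e := (\sum_(i < e) c i * p ^ i).

Lemma digit_sumS e : S e.+1 = S e + c e * p ^ e.
Proof. exact: big_ord_recr. Qed.

Lemma digit_sum_lt e : e <= k.+1 -> S e < p ^ e.
Proof.
elim: e => [|e IH] lt_ek; first by rewrite big_ord0.
have := IH (ltnW lt_ek); have := c_lt lt_ek.
rewrite digit_sumS expnS => lt_c lt_S.
by rewrite (leq_trans (_ : _ < (c e).+1 * p ^ e)) ?leq_mul2r ?lt_c ?orbT // mulSn ltn_add2r.
Qed.

Lemma digit_sum_modn e : e <= k.+1 -> (S k.+1) %% p ^ e = S e.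
Proof.
move=> le_ek; rewrite -(subnKC le_ek) big_split_ord /=.
rewrite [X in (_ + X) %% _](_ : _ = (\sum_(i < k.+1 - e) c (e + i) * p ^ i) * p ^ e).
  by rewrite addnC modnMDl modn_small // digit_sum_lt.
by rewrite big_distrl; apply: eq_bigr => i _; rewrite expnD [p ^ e * _]mulnC mulnA.
Qed.

Lemma digit_sum_ge : c k != 0 -> p ^ k <= S k.+1.
Proof. by rewrite digit_sumS -lt0n => ck; rewrite (leq_trans (leq_pmull _ ck)) ?leq_addl. Qed.
End Digits.

(** For odd q this means that x is (q - 1)/2 or (q + 1)/2. *)
Definition near_half q x := (q.-1 <= x.*2) && (x.*2 <= q.+1).

(** For p = 2h + 1 one has (pq - 1)/2 = hq + (q - 1)/2, and likewise with + 1, so the new leading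
    digit must be h. *)
Lemma near_half_digit h q x y : 2 < q -> near_half q x ->
  near_half (h.*2.+1 * q) (x + y * q) <-> y = h.
Proof.
move=> q_gt2 /andP[lo hi].
rewrite /near_half mulSn -doubleMl doubleD.
split=> [/andP[lo2 hi2]|->]; last by lia.
apply/eqP; rewrite eqn_leq; apply/andP; split; rewrite leqNgt; apply/negP => lt.
  have := leq_mul lt (leqnn q); rewrite mulSn; lia.
have := leq_mul lt (leqnn q); rewrite mulSn; lia.
Qed.

(** Since x and x' differ by at most 1, the lower parts and the slack 1 together stay below q. *)
Lemma leq_top_digit q x x' y y' : 2 < q -> near_half q x -> near_half q x' ->
  x + y * q <= (x' + y' * q).+1 <-> y <= y'.
Proof.
move=> q_gt2 /andP[lo hi] /andP[lo' hi']; split=> [le|le].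
  rewrite leqNgt; apply/negP => lt.
  have := leq_mul lt (leqnn q); rewrite mulSn; lia.
have := leq_mul le (leqnn q); lia.
Qed.

(** The lower parts add up to a number from q - 1 to q + 1, so the sum stays within pq + 1 exactly
    when y + y' + 1 <= p. *)
Lemma ltn_top_digits p q x x' y y' : 2 < q -> near_half q x -> near_half q x' ->
  x + y * q + (x' + y' * q) <= (p * q).+1 <-> y + y' < p.
Proof.
move=> q_gt2 /andP[lo hi] /andP[lo' hi']; split=> [le|lt].
  rewrite ltnNge; apply/negP => ge.
  have := leq_mul ge (leqnn q); rewrite mulnDl; lia.
have := leq_mul lt (leqnn q); rewrite mulSn mulnDl; lia.
Qed.

Lemma residue_conds_gt q a b : 1 < a -> a < q -> a <= b ->
  residue_conds q a b <-> a <= (b %% q).+1 /\ a + b %% q <= q.+1.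
Proof.
move=> a_gt1 lt_aq le_ab; have [le_qb|lt_bq] := leqP q b; first exact: residue_conds_between.
rewrite modn_small // residue_conds_lt //; last exact: leq_trans le_ab.
by split=> [->|[]//]; split=> //; apply: leqW.
Qed.

(** Passing from q to qr adds to b mod q a multiple of q that is at most q(r - 1), which preserves
    both bounds. Hence the first power of p above a decides all later ones. *)
Lemma residue_conds_gtM q r a b : 1 < a -> a < q -> a <= b -> 0 < r ->
  residue_conds q a b -> residue_conds (q * r) a b.
Proof.
move=> a_gt1 lt_aq le_ab r_gt0.
have q_gt0 : 0 < q by lia.
have le_q : q <= q * r by rewrite leq_pmulr.
rewrite !residue_conds_gt //; last exact: leq_trans le_q.
have := modn_dvdm b (dvdn_mulr r (dvdnn q)).
have := ltn_pmod b (leq_trans q_gt0 le_q).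
move: (b %% (q * r)) => y lt_y y_mod.
have -> : b %% q = y %% q by [].
have lt_z : (y %/ q).+1 <= r by rewrite -(ltn_pmul2l q_gt0) mulnC (leq_ltn_trans (leq_divM _ _)).
have le_z := leq_mul (leqnn q) lt_z.
rewrite {3 4}(divn_eq y q) => -[lo hi].
move: le_z; rewrite mulnS [q * (_ %/ _)]mulnC.
move: (y %/ q * q) (y %% q) lo hi => z x lo hi le_z; split; lia.
Qed.

(** * The three cases read off the digits *)

Section Cases.
Variables (p k l : nat) (a_ b_ : nat -> nat).
Hypotheses (p_odd : odd p) (p_gt2 : 2 < p).
Hypotheses (a_digit : forall i, i <= k -> a_ i < p) (b_digit : forall i, i <= l -> b_ i < p).
Hypotheses (ak_neq0 : a_ k != 0) (bl_neq0 : b_ l != 0) (k_le_l : k <= l).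
Let a := \sum_(i < k.+1) a_ i * p ^ i.
Let b := \sum_(i < l.+1) b_ i * p ^ i.
Hypotheses (a_gt1 : 1 < a) (b_gt1 : 1 < b).
Let conds := forall e, 0 < e -> residue_conds (p ^ e) a b.

Let p_gt0 : 0 < p. Proof. exact: ltn_trans p_gt2. Qed.

Lemma conds_lt_lt : a < p -> b < p -> conds <-> a + b <= p + 1.
Proof.
move=> lt_ap lt_bp; rewrite addn1; split=> [/(_ 1 isT)|le e e_gt0].
  by rewrite expn1 residue_conds_lt.
have le_pe : p <= p ^ e by rewrite -{1}[p]expn1 leq_pexp2l.
by rewrite residue_conds_lt ?(leq_trans le) ?(leq_trans _ le_pe).
Qed.

Lemma conds_lt_ge : a < p -> p <= b -> conds <-> a <= minn (b_ 0) (p - b_ 0) + 1.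
Proof.
move=> lt_ap le_pb.
have b0_lt := b_digit (leq0n l).
have le_ab : a <= b by lia.
have cond1 : residue_conds p a b <-> a <= minn (b_ 0) (p - b_ 0) + 1.
  have b0E : b %% p = b_ 0.
    by have := digit_sum_modn b_digit (ltn0Sn l); rewrite expn1 => ->; rewrite big_ord1 muln1.
  by rewrite residue_conds_gt // b0E; split=> [[]|]; lia.
rewrite -cond1; split=> [/(_ 1 isT)|cond [//|e] _]; first by rewrite expn1.
by rewrite expnS; apply: residue_conds_gtM; rewrite // expn_gt0 p_gt0.
Qed.

(** The first digit may be either half; by [near_half_digit] each further level forces one digit to
    be (p - 1)/2. *)
Lemma near_half_sums (c : nat -> nat) m : 0 < m ->
  (forall e, 0 < e -> e <= m -> near_half (p ^ e) (\sum_(i < e) c i * p ^ i)) <->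
  (c 0 = (p - 1) %/ 2 \/ c 0 = (p + 1) %/ 2) /\
  (forall i, 1 <= i -> i < m -> c i = (p - 1) %/ 2).
Proof.
move=> m_gt0.
have p_eq : p = ((p - 1) %/ 2).*2.+1 by lia.
have nh1 : near_half (p ^ 1) (\sum_(i < 1) c i * p ^ i) <->
    (c 0 = (p - 1) %/ 2 \/ c 0 = (p + 1) %/ 2).
  have -> : (p + 1) %/ 2 = ((p - 1) %/ 2).+1 by lia.
  rewrite big_ord1 /= expn0 muln1 expn1 /near_half.
  move: ((p - 1) %/ 2) p_eq => h p_eq; rewrite {}p_eq.
  split=> [/andP[lo hi]|[]->]; try by apply/andP; split; lia.
  have [lt_h|le_h] := ltnP h (c 0); [right | left]; lia.
have pe_gt2 e : 0 < e -> 2 < p ^ e.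
  by move=> e_gt0; rewrite (leq_trans p_gt2) // -{1}[p]expn1 leq_pexp2l.
split=> [nh|[c0 cs]].
  split=> [|i i_ge1 lt_im]; first by apply/nh1/nh.
  have := nh i.+1 isT lt_im; rewrite digit_sumS expnS {1}p_eq.
  by rewrite near_half_digit ?pe_gt2 ?nh // ltnW.
elim=> // -[_ _ _|e IH _ lt_em]; first exact/nh1.
rewrite digit_sumS expnS {1}p_eq near_half_digit ?pe_gt2 ?IH ?cs //; exact: ltnW.
Qed.

(** Since p^k <= a < p^(k + 1), the powers up to p^k govern the digits below k, and given these, the
    higher powers govern the digits at k. *)
Lemma conds_ge_ge : p <= a -> p <= b -> conds <->
  [/\ ((a_ 0 = (p - 1) %/ 2 \/ a_ 0 = (p + 1) %/ 2) /\
       (b_ 0 = (p - 1) %/ 2 \/ b_ 0 = (p + 1) %/ 2)),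
      (forall i, 1 <= i -> i < k -> a_ i = (p - 1) %/ 2 /\ b_ i = (p - 1) %/ 2)
    & (a_ k + b_ k <= p - 1 /\ (k < l -> a_ k <= b_ k))].
Proof.
move=> le_pa le_pb.
have lt_a : a < p ^ k.+1 := digit_sum_lt a_digit (leqnn _).
have k_gt0 : 0 < k.
  rewrite lt0n; apply: contraTneq lt_a => k0.
  by rewrite -leqNgt [X in p ^ X.+1]k0 expn1.
have low e : 0 < e -> e <= k -> residue_conds (p ^ e) a b <->
    near_half (p ^ e) (\sum_(i < e) a_ i * p ^ i) /\
    near_half (p ^ e) (\sum_(i < e) b_ i * p ^ i).
  move=> e_gt0 le_ek; have le_el := leq_trans le_ek k_le_l.
  rewrite residue_conds_ge ?oddX ?p_odd ?orbT //.
  - rewrite (digit_sum_modn a_digit (leqW le_ek)) (digit_sum_modn b_digit (leqW le_el)).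
    by rewrite /near_half; split=> [[-> -> -> ->]|[/andP[-> ->] /andP[-> ->]]].
  - by rewrite -(exp1n e) ltn_exp2r // ltnW.
  - by apply: leq_trans _ (digit_sum_ge p ak_neq0); rewrite leq_pexp2l.
  - by apply: leq_trans _ (digit_sum_ge p bl_neq0); rewrite leq_pexp2l.
have pk_gt2 : 2 < p ^ k by rewrite (leq_trans p_gt2) // -{1}[p]expn1 leq_pexp2l.
have high : near_half (p ^ k) (\sum_(i < k) a_ i * p ^ i) ->
    near_half (p ^ k) (\sum_(i < k) b_ i * p ^ i) ->
    (forall e, k < e -> residue_conds (p ^ e) a b) <->
    a_ k + b_ k <= p - 1 /\ (k < l -> a_ k <= b_ k).
  move=> nh_a nh_b; have [lt_kl|] := ltnP k l.
    have le_ab : a <= b.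
      rewrite (leq_trans (ltnW lt_a)) // (leq_trans _ (digit_sum_ge p bl_neq0)) //.
      by rewrite leq_pexp2l.
    have -> : (forall e, k < e -> residue_conds (p ^ e) a b) <-> residue_conds (p ^ k.+1) a b.
      split=> [|cond e lt_ke]; first exact.
      by rewrite -(subnKC lt_ke) expnD; apply: residue_conds_gtM; rewrite // expn_gt0 p_gt0.
    (* Modulo p^(k + 1), b keeps its digits up to k; the two bounds then compare a_k with b_k and
       a_k + b_k with p. *)
    rewrite residue_conds_gt // (digit_sum_modn b_digit (leqW lt_kl)) /a !digit_sumS expnS.
    rewrite leq_top_digit // ltn_top_digits //.
    by split=> [[le lt]|[le /(_ isT) lt]]; split=> //; lia.
  (* Both numbers are now below every p^e with e > k, and e = k + 1 is the strictest case. *)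
  move=> le_lk; have l_eq : l = k by lia.
  have := digit_sum_lt b_digit (leqnn _); rewrite [X in p ^ X.+1]l_eq -/b => lt_b.
  have -> : (forall e, k < e -> residue_conds (p ^ e) a b) <-> a + b <= (p ^ k.+1).+1.
    split=> [/(_ _ (leqnn _))|le e lt_ke]; first by rewrite residue_conds_lt.
    have le_pe : p ^ k.+1 <= p ^ e by rewrite leq_pexp2l.
    by rewrite residue_conds_lt ?(leq_trans le) ?(leq_trans _ le_pe).
  rewrite /a /b l_eq !digit_sumS expnS ltn_top_digits //.
  by split=> [lt|[lt _]]; [split|]; lia.
have halves := (near_half_sums a_ k_gt0, near_half_sums b_ k_gt0).
split=> [cond|[[a0 b0] mid top]].
  have nh e : 0 < e -> e <= k -> _ := fun e0 ek => (low e e0 ek).1 (cond e e0).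
  have [a0 amid] := halves.1.1 (fun e e0 ek => (nh e e0 ek).1).
  have [b0 bmid] := halves.2.1 (fun e e0 ek => (nh e e0 ek).2).
  split=> // [i i1 ik|]; first by rewrite amid ?bmid.
  have [nha nhb] := nh k k_gt0 (leqnn k).
  by apply/(high nha nhb) => e lt_ke; apply: cond; apply: leq_ltn_trans lt_ke.
have nha := halves.1.2 (conj a0 (fun i i1 ik => (mid i i1 ik).1)).
have nhb := halves.2.2 (conj b0 (fun i i1 ik => (mid i i1 ik).2)).
move=> e e_gt0; have [le_ek|lt_ke] := leqP e k; first by apply/low => //; split; auto.
by apply: (high (nha _ k_gt0 (leqnn k)) (nhb _ k_gt0 (leqnn k))).2.
Qed.
End Cases.

Theorem theorem3p2 (K : fieldType) (p a b : nat)
  (p_char : p \in [pchar K]%R) (p_gt2 : 2 < p)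
  (a_ge2 : 2 <= a) (b_ge2 : 2 <= b)
  (k l : nat) (a_ b_ : nat -> nat)
  (a_def : a = \sum_(i < k.+1) a_ i * p ^ i)
  (b_def : b = \sum_(i < l.+1) b_ i * p ^ i)
  (a_digit : forall i, i <= k -> a_ i < p)
  (b_digit : forall i, i <= l -> b_ i < p)
  (ak_neq0 : a_ k != 0) (bl_neq0 : b_ l != 0)
  (k_le_l : k <= l) :
  let SLP := mci_SLP K (ltnW a_ge2) (ltnW b_ge2) in
  [/\ (a < p -> b < p -> (SLP <-> a + b <= p + 1)),
      (a < p -> p <= b -> (SLP <-> a <= minn (b_ 0) (p - b_ 0) + 1))
    & (p <= a -> p <= b ->
       (SLP <->
        [/\ ((a_ 0 = (p - 1) %/ 2 \/ a_ 0 = (p + 1) %/ 2) /\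
             (b_ 0 = (p - 1) %/ 2 \/ b_ 0 = (p + 1) %/ 2)),
            (forall i, 1 <= i -> i < k ->
               a_ i = (p - 1) %/ 2 /\ b_ i = (p - 1) %/ 2)
          & (a_ k + b_ k <= p - 1 /\ (k < l -> a_ k <= b_ k))]))].
Proof.
move=> SLP.
have p_pr := pcharf_prime p_char.
have p_odd : odd p by case: (even_prime p_pr) p_gt2 => [->|].
have SLP_conds : SLP <-> forall e, 0 < e -> residue_conds (p ^ e) a b.
  rewrite /SLP SLP_det //; split=> [dets e e_gt0 n n_gt0 lt_n|conds n n_gt0 lt_n].
    exact: (det_binmx_neq0 _ _ _ p_char).1 (dets n n_gt0 lt_n) e e_gt0.
  by apply/(det_binmx_neq0 _ _ _ p_char) => e e_gt0; apply: conds.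
subst a b; split=> *; rewrite SLP_conds.
- exact: conds_lt_lt.
- exact: conds_lt_ge.
exact: conds_ge_ge.
Qed.
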